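(* Let $n\ge1$ and $d\ge 0$ be integers, let $a,b>0$ be real numbers, and let $P_A(\lambda)=\sum_{i=0}^d A_i\lambda^i$ be a matrix polynomial whose coefficients $A_i\in\mathbb C^{n\times n}$ are Hermitian matrices satisfying $bI\le A_i\le aI$ for all $i=0,\dots,d$. Then for all orthogonal unit vectors $x,y\in\mathbb C^n$ and all $\lambda\in\mathbb C$, $$|x^*P_A(\lambda)y|^2\le\Big(\frac{a-b}{a+b}\Big)^2\,\big(x^*P_A(|\lambda|)x\big)\cdot\big(y^*P_A(|\lambda|)y\big).$$
   Context: $I$ is the $n\times n$ identity matrix, and $X\le Y$ for Hermitian matrices means that $Y-X$ is positive semidefinite. Orthogonality and unit length are with respect to the standard inner product on $\mathbb C^n$; $x^*$ is the conjugate transpose of $x$. *)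

(* Defs.v *)
From HB Require Import structures.
From mathcomp Require Import all_boot all_order all_algebra.
From mathcomp Require Import reals complex.
Set Implicit Arguments.
Unset Strict Implicit.
Unset Printing Implicit Defensive.
Import Order.TTheory GRing.Theory Num.Theory.
Local Open Scope ring_scope.
Local Open Scope sesquilinear_scope.

(* The complex field is R[i] for R : realType. In the partial order of R[i],
   z <= w means that w - z is a nonnegative real number, so 0 <= z contains the
   claim that z is real. *)

Section Definitions.
Variables (R : realType) (n : nat).
Local Notation C := R[i].

Definition cform (A : 'M[C]_n) (x y : 'cV[C]_n) : C := (x ^t* *m A *m y) 0 0.

Definition cdot (x y : 'cV[C]_n) : C := (x ^t* *m y) 0 0.

Definition cnorm (x : 'cV[C]_n) : C := sqrtC (cdot x x).

Definition psdmx (A : 'M[C]_n) : Prop :=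
  A \is hermsymmx /\ forall x : 'cV[C]_n, 0 <= cform A x x.

Definition loewner_le (X Y : 'M[C]_n) : Prop := psdmx (Y - X).

Definition mxpoly_eval (d : nat) (A : 'I_d.+1 -> 'M[C]_n) (l : C) : 'M[C]_n :=
  \sum_(i < d.+1) l ^+ i *: A i.

End Definitions.

(* Main.v *)
Require Import Defs.
From HB Require Import structures.
From mathcomp Require Import all_boot all_order all_algebra.
From mathcomp Require Import reals complex ring.
Import Order.TTheory GRing.Theory Num.Theory.
Local Open Scope ring_scope.
Local Open Scope complex_scope.

(** Let [z = x^* A y], [p = x^* A x], [q = y^* A y] with [b I <= A <= a I], and
    let [c] be a phase with [c z = |z|].  For real [s], [t] the vectors
    [s x + t c y] and [s x - t c y] both have squared norm [s^2 + t^2], so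
    [s^2 p + t^2 q + 2 s t |z| <= a (s^2 + t^2)] and
    [b (s^2 + t^2) <= s^2 p + t^2 q - 2 s t |z|].  Eliminating [s^2 + t^2] gives
    [2 s t |z| <= k (s^2 p + t^2 q)] with [k = (a - b) / (a + b)].
    This form of Wielandt's inequality is linear in [A], hence can be summed
    over the coefficients with the weights [|lambda|^i]; optimising over [s] and
    [t] only afterwards gives the product bound. *)

Section Forms.
Set Implicit Arguments.
Unset Strict Implicit.
Variables (R : realType) (n : nat).
Local Notation C := R[i].
Implicit Types (A B : 'M[C]_n) (x y u v : 'cV[C]_n).

Lemma cformDr A x u v : cform A x (u + v) = cform A x u + cform A x v.
Proof. by rewrite /cform mulmxDr mxE. Qed.

Lemma cformDl A u v y : cform A (u + v) y = cform A u y + cform A v y.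
Proof. by rewrite /cform linearD map_mxD !mulmxDl mxE. Qed.

Lemma cformZr A x (c : C) y : cform A x (c *: y) = c * cform A x y.
Proof. by rewrite /cform -scalemxAr mxE. Qed.

Lemma cformZl A (c : C) x y : cform A (c *: x) y = Num.conj c * cform A x y.
Proof. by rewrite /cform linearZ map_mxZ -!scalemxAl mxE. Qed.

Lemma cform_sumZ (I : finType) (w : I -> C) (A : I -> 'M[C]_n) x y :
  cform (\sum_i w i *: A i) x y = \sum_i w i * cform (A i) x y.
Proof.
rewrite /cform mulmx_sumr mulmx_suml summxE.
by apply: eq_bigr => i _; rewrite -scalemxAr -scalemxAl mxE.
Qed.

Lemma cformB A B x y : cform (A - B) x y = cform A x y - cform B x y.
Proof. by rewrite /cform mulmxBr mulmxBl !mxE. Qed.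

Lemma cform_scalar (c : C) x y : cform c%:M x y = c * cdot x y.
Proof. by rewrite /cform /cdot mul_mx_scalar -scalemxAl mxE. Qed.

Lemma cform_conj A x y :
  A \is hermsymmx -> Num.conj (cform A x y) = cform A y x.
Proof.
move/is_hermitianmxP; rewrite expr0 scale1r => hA.
(* A 1x1 matrix equals its transpose, so conjugating its entry amounts to taking the adjoint of the
   whole product. *)
transitivity (map_mx Num.conj (trmx (map_mx Num.conj (trmx x) *m A *m y)) 0 0).
  by rewrite /cform [RHS]mxE [in RHS]mxE.
rewrite /cform [in RHS]hA !trmx_mul !map_mxM mulmxA.
congr ((_ *m _ *m _) 0 0).
by apply/matrixP=> i j; rewrite !mxE; exact: conjCK.
Qed.

Lemma loewner_le_cform A B x : loewner_le A B -> cform A x x <= cform B x x.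
Proof. by case=> _ /(_ x); rewrite cformB subr_ge0. Qed.

Lemma cnorm_eq1 x : cnorm x = 1 -> cdot x x = 1.
Proof. by rewrite /cnorm => h; rewrite -[LHS]sqrtCK h expr1n. Qed.

Lemma exists_phase (z : C) : exists c : C, Num.conj c * c = 1 /\ c * z = `|z|.
Proof.
have [->|z0] := eqVneq z 0.
  by exists 1; rewrite rmorph1 mulr1 mulr0 normr0.
have nz0 : `|z| != 0 by rewrite normr_eq0.
exists (Num.conj z / `|z|); split.
  rewrite rmorphM fmorphV /= conjCK conj_normC.
  by rewrite mulrACA -normCK -expr2 exprVn divff // expf_neq0.
by rewrite mulrAC -normCKC expr2 mulfK.
Qed.

(** The cross terms are [s * t * (c * z)], with [z] the form at [x], [y], and its conjugate; the
    phase turns both into [s * t * |z|]. *)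
Lemma cform_comb A x y (s t c : C) : A \is hermsymmx ->
    s \is Num.real -> t \is Num.real ->
    Num.conj c * c = 1 -> c * cform A x y = `|cform A x y| ->
  cform A (s *: x + (t * c) *: y) (s *: x + (t * c) *: y) =
  s ^+ 2 * cform A x x + t ^+ 2 * cform A y y + 2 * s * t * `|cform A x y|.
Proof.
move=> hA /CrealP sR /CrealP tR c1 cz.
have cz' : Num.conj c * cform A y x = `|cform A x y|.
  by rewrite -(cform_conj _ _ hA) -rmorphM cz /= conj_normC.
rewrite !cformDl !cformDr !cformZl !cformZr rmorphM /= sR tR.
transitivity (s ^+ 2 * cform A x x + t ^+ 2 * (Num.conj c * c) * cform A y y
  + s * t * (c * cform A x y) + s * t * (Num.conj c * cform A y x)).
  by ring.
by rewrite c1 cz cz'; ring.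
Qed.

Lemma wielandt_linear A (a b s t : C) x y :
    0 < a -> 0 < b -> A \is hermsymmx ->
    loewner_le b%:M A -> loewner_le A a%:M ->
    cdot x x = 1 -> cdot y y = 1 -> cdot x y = 0 ->
    s \is Num.real -> t \is Num.real ->
  2 * s * t * `|cform A x y| <=
    (a - b) / (a + b) * (s ^+ 2 * cform A x x + t ^+ 2 * cform A y y).
Proof.
move=> a0 b0 hA leA geA xx yy xy sR tR.
have [c [c1 cz]] := exists_phase (cform A x y).
have I1 : (1%:M : 'M[C]_n) \is hermsymmx.
  by apply/is_hermitianmxP; rewrite expr0 scale1r trmx1 map_mx1.
(* Viewing [cdot] as the form of the identity lets [cform_comb] compute squared norms too; there
   orthogonality kills the cross term. *)
have dotE u v : cdot u v = cform 1%:M u v by rewrite cform_scalar mul1r.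
have normE r : r \is Num.real ->
    cdot (s *: x + (r * c) *: y) (s *: x + (r * c) *: y) = s ^+ 2 + r ^+ 2.
  move=> rR; rewrite dotE cform_comb -?dotE //; last by rewrite xy mulr0 normr0.
  by rewrite xx yy xy normr0 mulr0 addr0 !mulr1.
have hi := loewner_le_cform (s *: x + (t * c) *: y) geA.
have tNR : - t \is Num.real by rewrite rpredN.
have lo := loewner_le_cform (s *: x + (- t * c) *: y) leA.
rewrite cform_scalar normE // cform_comb // in hi.
rewrite cform_scalar normE // cform_comb // sqrrN mulrN mulNr in lo.
set m := s ^+ 2 * _ + _ in hi lo *; set w := _ * `|_| in hi lo *.
have ab0 : 0 < a + b by rewrite addr_gt0.
rewrite [leRHS]mulrAC ler_pdivlMr //.
(* With [N = s^2 + t^2], this chains [b (m + w) <= a b N <= a (m - w)], that is,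
   [(a + b) w <= (a - b) m]. *)
have := ler_wpM2l (ltW a0) lo; rewrite mulrCA.
move/(le_trans (ler_wpM2l (ltW b0) hi)).
by rewrite -subr_ge0 => h; rewrite -subr_ge0; congr (0 <= _): h; ring.
Qed.

End Forms.

(** A discriminant bound: for fixed [s] and [k > 0], the gap between the two sides is smallest at
    [t = s W / (k Q)]. Scaling to [s = k Q], [t = W] avoids division and square roots. *)
Lemma sqr_le_of_quadratic (F : numFieldType) (k P Q W : F) :
    0 <= k -> 0 < Q -> 0 <= W ->
    (forall s t : F, 0 <= s -> 0 <= t ->
      2 * s * t * W <= k * (s ^+ 2 * P + t ^+ 2 * Q)) ->
  W ^+ 2 <= k ^+ 2 * (P * Q).
Proof.
move=> k0 Q0 W0 h.
move: k0; rewrite le_eqVlt => /predU1P[k0 | k0].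
  (* For [k = 0] this choice gives [2 W^2 <= 0]. *)
  have := h 1 W ler01 W0.
  rewrite -k0 mul0r expr0n mul0r mulr1 -mulrA -expr2.
  by rewrite pmulr_rle0.
have kQ0 : 0 < k * Q by rewrite mulr_gt0.
have := h (k * Q) W (ltW kQ0) W0.
rewrite -subr_ge0 => h'; rewrite -subr_ge0 -(pmulr_rge0 _ kQ0).
by congr (0 <= _): h'; ring.
Qed.

Theorem theorem2p5 (R : realType) (n d : nat) (n_ge1 : (1 <= n)%N)
    (a b : R) (a_gt0 : 0 < a) (b_gt0 : 0 < b)
    (A : 'I_d.+1 -> 'M[R[i]]_n)
    (A_herm : forall i, A i \is hermsymmx)
    (A_ge : forall i, loewner_le (b%:C)%:M (A i))
    (A_le : forall i, loewner_le (A i) (a%:C)%:M)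
    (x y : 'cV[R[i]]_n)
    (x_unit : cnorm x = 1) (y_unit : cnorm y = 1) (xy_orth : cdot x y = 0)
    (lambda : R[i]) :
  `|cform (mxpoly_eval A lambda) x y| ^+ 2 <=
    (((a - b) / (a + b)) ^+ 2)%:C *
      (cform (mxpoly_eval A `|lambda|) x x * cform (mxpoly_eval A `|lambda|) y y).
Proof.
have xx := cnorm_eq1 x_unit; have yy := cnorm_eq1 y_unit.
have aC : 0 < a%:C by rewrite ltcR.
have bC : 0 < b%:C by rewrite ltcR.
have ge_b i u : cdot u u = 1 -> b%:C <= cform (A i) u u.
  by move=> u1; have := loewner_le_cform u (A_ge i); rewrite cform_scalar u1 mulr1.
have le_a i u : cdot u u = 1 -> cform (A i) u u <= a%:C.
  by move=> u1; have := loewner_le_cform u (A_le i); rewrite cform_scalar u1 mulr1.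
(* Squeezing the form of [A ord0] at the unit vector [x] yields [b <= a], hence [k >= 0]. *)
have le_ba : b%:C <= a%:C := le_trans (ge_b ord0 x xx) (le_a ord0 x xx).
rewrite rmorphXn /= fmorph_div rmorphB rmorphD /=.
rewrite /mxpoly_eval !cform_sumZ.
apply: sqr_le_of_quadratic => //.
- by rewrite divr_ge0 ?subr_ge0 // addr_ge0 // ltW.
(* The term of index 0 has weight 1 and is at least [b], so the sum is positive even when
   [lambda = 0]. *)
- rewrite big_ord_recl expr0 mul1r ltr_pwDl //.
    exact: lt_le_trans bC (ge_b _ _ yy).
  apply: sumr_ge0 => i _; rewrite mulr_ge0 ?exprn_ge0 //.
  exact: le_trans (ltW bC) (ge_b _ _ yy).
move=> s t s0 t0.
have st0 : 0 <= 2 * s * t by rewrite !mulr_ge0 ?ler0n.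
(* The triangle inequality replaces the weights [lambda ^+ i] by [|lambda| ^+ i], the same as on the
   right, so terms can be compared one by one. *)
apply: le_trans (ler_wpM2l st0 (ler_norm_sum _ _ _)) _.
rewrite !mulr_sumr -big_split /= mulr_sumr.
apply: ler_sum => i _.
rewrite normrM normrX mulrCA.
set w := `|lambda| ^+ i.
rewrite (mulrCA _ w) (mulrCA _ w) -mulrDr (mulrCA _ w).
apply: ler_wpM2l; first by rewrite exprn_ge0.
by apply: wielandt_linear; rewrite ?ger0_real.
Qed.
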